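(* One has $\mathcal{N}_{n,4}\subset\mathcal{SN}_{n,3}$ for $n=5,6,7$, and $\mathcal{N}_{7,6}\subset\mathcal{SN}_{7,5}$. (In particular, every nilpotent real Lie algebra $\mathfrak{g}$ of dimension $7$ satisfies $[\mathfrak{g}^1,\mathfrak{g}^3]=0$.)
   Context: Let $\mathfrak{g}$ be an $n$-dimensional real vector space. For $\mu\in\Lambda^2\mathfrak{g}^*\otimes\mathfrak{g}$ put $J(\mu)(x,y,z)=\sum_{cyclic}\mu(\mu(x,y),z)$, $N_1(\mu)(x_1,x_2)=\mu(x_1,x_2)$, $N_k(\mu)(x_1,\dots,x_{k+1})=\mu(N_{k-1}(\mu)(x_1,\dots,x_k),x_{k+1})$, and for $k\ge3$ $$SN_k(\mu)(x_1,\dots,x_{k+1})=\mu\big(\mu(x_1,x_2),N_{k-2}(\mu)(x_3,\dots,x_{k+1})\big).$$ Then $\mathcal{N}_{n,k}=\{\mu: J(\mu)=0,\ N_k(\mu)=0\}$ is the variety of (at most) $k$-step nilpotent Lie algebra structures on $\mathfrak{g}$, and $\mathcal{SN}_{n,k}=\{\mu: J(\mu)=0,\ SN_k(\mu)=0\}$. The descending central series is indexed by $\mathfrak{g}^0=\mathfrak{g}$, $\mathfrak{g}^i=[\mathfrak{g}^{i-1},\mathfrak{g}]$. *)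

(* Defs.v *)
From mathcomp Require Import all_boot all_order all_algebra.
From mathcomp Require Import all_classical all_reals.

Set Implicit Arguments.
Unset Strict Implicit.
Unset Printing Implicit Defensive.

Import GRing.Theory.
Local Open Scope classical_set_scope.
Local Open Scope ring_scope.

(* The space Lambda^2 g^* (x) g, presented as alternating bilinear maps. *)
Record altmap (R : realType) (g : vectType R) := AltMap {
  altmap_val :> {bilinear g -> g -> g};
  altmap_alt : forall x : g, altmap_val x x = 0
}.

Section Brackets.
Variables (R : realType) (g : vectType R).
Implicit Types (mu : altmap g) (U W X : {vspace g}).

Definition jac mu (x y z : g) : g :=
  mu (mu x y) z + mu (mu y z) x + mu (mu z x) y.

Definition jacobi mu := forall x y z : g, jac mu x y z = 0.

(* The argument list (x_1, ..., x_{k+1}) is a family x : 'I_k.+1 -> g indexed  *)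
(* from 0.  The value at k = 0 is a convention (the identity) chosen so that   *)
(* Nmap mu 1 x is mu x_1 x_2.                                                  *)
Fixpoint Nmap mu (k : nat) : ('I_k.+1 -> g) -> g :=
  match k return ('I_k.+1 -> g) -> g with
  | 0 => fun x => x ord0
  | k'.+1 => fun x =>
      mu (Nmap mu (fun i : 'I_k'.+1 => x (widen_ord (leqnSn k'.+1) i)))
         (x ord_max)
  end.

(* Meaningful for 3 <= k only; then no argument of inord is out of range. *)
Definition SNmap mu (k : nat) (x : 'I_k.+1 -> g) : g :=
  mu (mu (x (inord 0)) (x (inord 1)))
     (@Nmap mu (k - 2)%N (fun i => x (inord (i + 2)%N))).

Definition nil_variety (k : nat) : set (altmap g) :=
  [set mu | jacobi mu /\ forall x : 'I_k.+1 -> g, Nmap mu x = 0].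

Definition snil_variety (k : nat) : set (altmap g) :=
  [set mu | jacobi mu /\ forall x : 'I_k.+1 -> g, SNmap mu x = 0].

(* [U, W] is the span of all brackets mu u w with u in U and w in W; by        *)
(* bilinearity, bases of U and W suffice, see brv_subP.                        *)
Definition brv mu U W : {vspace g} :=
  <<[seq mu u w | u <- vbasis U, w <- vbasis W]>>%VS.

Lemma brv_subP mu U W X :
  reflect {in U & W, forall u w, mu u w \in X} (brv mu U W <= X)%VS.
Proof.
apply: (iffP span_subvP) => [sX u w uU wW | sX _ /allpairsP[[u w] /= [uU wW ->]]].
  rewrite (coord_vbasis uU) (coord_vbasis wW) linear_sumr memv_suml// => i _.
  rewrite linearZr_LR rpredZ// linear_sumlz memv_suml// => j _.
  rewrite linearZl_LR rpredZ// sX//.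
  by apply: allpairs_f; apply: mem_nth; rewrite size_tuple.
by apply: sX; apply: vbasis_mem.
Qed.

Fixpoint lcs mu (i : nat) : {vspace g} :=
  if i is i'.+1 then brv mu (lcs mu i') fullv else fullv.

Definition nilpotent_alg mu := exists k : nat, lcs mu k = 0%VS.

End Brackets.

Arguments nil_variety {R} g k.
Arguments snil_variety {R} g k.

(* Main.v *)
Require Import Defs.
From mathcomp Require Import all_boot all_order all_algebra.
From mathcomp Require Import all_classical all_reals.
From mathcomp Require Import zify.
Local Open Scope classical_set_scope.
Local Open Scope ring_scope.

Set Implicit Arguments.
Unset Strict Implicit.
Unset Printing Implicit Defensive.

Import GRing.Theory Num.Theory.

(** Write L_i for [lcs mu i] and d_i for the dimension of L_i / L_(i+1). Two
    general facts leave one sequence of dimensions to examine for each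
    inclusion: [L_i, L_j] lies in L_(i+j+1) ([lcs_weight]), and generators
    modulo L_1, bracketed with generators of L_i modulo L_(i+1), generate
    L_(i+1) modulo L_(i+2) ([lcs_gen]). In particular d_0 <= 2 forces d_1 <=
    1, and if d_i <= 1 then [L_i, L_i] lies in L_(2i+2)
    ([lcs_cyclic_abelian]).

    Suppose first that L_4 = 0. If d_1 <= 1, or if L_3, which contains [L_1,
    L_1], vanishes, then L_1 is abelian. Otherwise d_0 >= 3 and d_1 >= 2, so
    in dimension at most 7 the dimensions are (3, 2, 1, 1). Here the three
    brackets of the generators are linearly dependent modulo L_2, and every
    element of the second exterior power of a 3-dimensional space is
    decomposable; hence generators can be chosen with [x1, x2] in L_2. A
    further change in the plane of x1 and x2, of determinant one, makes x1
    centralize L_2, because L_3 is a line. The Jacobi identity then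
    gives [[x1, x3], [x2, x3]] = 0 ([three_generators_metabelian]).

    Suppose next that the dimension is 7 and the algebra is nilpotent. Since
    [L_1, L_3] lies in L_5, only the case L_5 <> 0 matters, and there the
    dimensions are (2, 1, 1, 1, 1, 1), because d_0 >= 2 ([lcs1_codim]). Choose
    generators x, y and e in L_2 spanning it modulo L_3 such that [y, e] lies
    in L_4. Then [x, y] and [x, e] generate L_1 modulo L_2 and L_3 modulo L_4,
    and the Jacobi identity shows that they commute ([filiform_bracket0]). The
    inclusion for 6-step structures is a special case.

    Both changes of generators are instances of [unimodular_choice], and both
    computations end with an equation of the form [v = - v]. *)

(** * Subspaces of small codimension *)

Section Subspaces.
Variables (K : fieldType) (V : vectType K).
Implicit Types (U W : {vspace V}) (u v : V).

Lemma mem_add_line U W u v :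
  (W <= <[u]> + U)%VS -> v \in W -> exists k, v - k *: u \in U.
Proof.
move=> /subvP sW /sW /memv_addP[_ /vlineP[k ->] [w wU ->]].
by exists k; rewrite addrC addKr.
Qed.

(** A basis of a complement of U in W, padded with zeros so that its length is
    the bound k itself. *)
Lemma subv_complement U W k :
  (U <= W)%VS -> (\dim W <= \dim U + k)%N ->
  exists s : seq V, [/\ size s = k, (<<s>> <= W)%VS & (W <= <<s>> + U)%VS].
Proof.
move=> sUW dW; have dD : (\dim (W :\: U) <= k)%N.
  by have := dimv_cap_compl W U; rewrite (capv_idPr sUW); lia.
exists (vbasis (W :\: U) ++ nseq (k - \dim (W :\: U)) 0); split.
- by rewrite size_cat size_tuple size_nseq subnKC.
- apply/span_subvP => v; rewrite mem_cat => /orP[/vbasis_mem|].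
    exact/subvP/diffvSl.
  by rewrite mem_nseq => /andP[_ /eqP->]; rewrite mem0v.
- rewrite span_cat (span_basis (vbasisP _)) -{1}(addv_diff_cap W U).
  rewrite (capv_idPr sUW) -addvA; apply: addvS; rewrite ?subvv//.
  exact: addvSr.
Qed.

Lemma subv_add_line U W u :
  (U <= W)%VS -> (\dim W <= (\dim U).+1)%N -> u \in W -> u \notin U ->
  (W <= <[u]> + U)%VS.
Proof.
move=> sUW dW uW uU.
have sW : (<[u]> + U <= W)%VS by rewrite subv_add sUW andbT -memvE.
rewrite -(geq_leqif (dimv_leqif_sup sW)); apply: leq_trans dW _.
rewrite (ltn_leqif (dimv_leqif_sup (addvSr _ _))).
by rewrite subv_add subvv andbT -memvE.
Qed.

End Subspaces.

(** * Brackets of subspaces *)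

Section LowerCentralSeries.
Variables (R : realType) (g : vectType R) (mu : altmap g).
Hypothesis Jmu : jacobi mu.
Implicit Types (U W X Y : {vspace g}) (u v w x y z : g).

Local Notation lcs := (lcs mu).
Local Notation brv := (brv mu).

Lemma eq_opp_eq0 v : v = - v -> v = 0.
Proof.
move=> /eqP; rewrite -addr_eq0 -mulr2n -scaler_nat scaler_eq0 pnatr_eq0 /=.
by move/eqP.
Qed.

Lemma mu_anti x y : mu x y = - mu y x.
Proof.
have := altmap_alt mu (x + y).
rewrite linearDl !linearDr !altmap_alt add0r addr0 => /eqP.
by rewrite addr_eq0 => /eqP.
Qed.

(** The Jacobi identity in the form: the map [mu x] is a derivation. *)
Lemma mu_leibniz x y z : mu x (mu y z) = mu (mu x y) z + mu y (mu x z).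
Proof.
have := Jmu x y z; rewrite /jac (mu_anti (mu y z)) (mu_anti (mu z x)).
rewrite (mu_anti z x) linearNr opprK addrAC => /eqP.
by rewrite subr_eq0 => /eqP.
Qed.

Lemma mem_brv U W u w : u \in U -> w \in W -> mu u w \in brv U W.
Proof. by move: u w; apply/brv_subP/subvv. Qed.

Lemma brvS U U' W W' :
  (U <= U')%VS -> (W <= W')%VS -> (brv U W <= brv U' W')%VS.
Proof.
move=> /subvP sU /subvP sW; apply/brv_subP => u w uU wW.
by apply: mem_brv; [apply: sU | apply: sW].
Qed.

Lemma brv_addl U U' W : (brv (U + U') W <= brv U W + brv U' W)%VS.
Proof.
apply/brv_subP => _ w /memv_addP[u uU [u' uU' ->]] wW.
by rewrite linearDl; apply: memv_add; apply: mem_brv.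
Qed.

Lemma brv_addr U W W' : (brv U (W + W') <= brv U W + brv U W')%VS.
Proof.
apply/brv_subP => u _ uU /memv_addP[w wW [w' wW' ->]].
by rewrite linearDr; apply: memv_add; apply: mem_brv.
Qed.

Lemma brv_line u w : (brv <[u]> <[w]> <= <[mu u w]>)%VS.
Proof.
apply/brv_subP => _ _ /vlineP[a ->] /vlineP[b ->].
by rewrite linearZl_LR linearZr_LR !rpredZ// memv_line.
Qed.

Lemma brv_line_self u : brv <[u]> <[u]> = 0%VS.
Proof.
apply/eqP; rewrite -subv0; apply: subv_trans (brv_line _ _) _.
by rewrite altmap_alt -memvE mem0v.
Qed.

Lemma brv_anti_sub U W : (brv U W <= brv W U)%VS.
Proof. by apply/brv_subP => u w uU wW; rewrite mu_anti rpredN mem_brv. Qed.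

(** * The lower central series *)

Lemma lcsS_sub i : (lcs i.+1 <= lcs i)%VS.
Proof. by elim: i => [|i IH]; [apply: subvf | apply: brvS]. Qed.

Lemma lcs_sub i j : (i <= j)%N -> (lcs j <= lcs i)%VS.
Proof.
move=> /subnK <-; elim: (j - i)%N => [//|n IH].
exact: subv_trans (lcsS_sub _) IH.
Qed.

(** Induction on j: writing an element of L_(j+1) through brackets [w, x] with
    w in L_j, the derivation [mu u] yields [[u, w], x] and [w, [u, x]], where
    [u, x] has weight one more than u. *)
Lemma lcs_weight i j u v :
  u \in lcs i -> v \in lcs j -> mu u v \in lcs (i + j).+1.
Proof.
elim: j i u v => [|j IH] i u v uL vL.
  by rewrite addn0; apply: mem_brv uL (memvf _).
suff /subvP/(_ v vL) : (lcs j.+1 <= linfun (mu u) @^-1: lcs (i + j.+1).+1)%VS.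
  by rewrite -memv_preim lfunE.
apply/brv_subP => w x wL _.
rewrite -memv_preim lfunE /= mu_leibniz addnS rpredD//.
  exact: mem_brv (IH _ _ _ uL wL) (memvf _).
have := IH i.+1 (mu u x) w (mem_brv uL (memvf x)) wL.
by rewrite addSn mu_anti rpredN.
Qed.

Lemma lcs_weight0 k i j u v :
  lcs k = 0%VS -> (k <= (i + j).+1)%N ->
  u \in lcs i -> v \in lcs j -> mu u v = 0.
Proof.
move=> Lk le_k uL vL; apply/eqP; rewrite -memv0 -Lk.
exact/(subvP (lcs_sub le_k))/lcs_weight.
Qed.

(** The error terms of u = y + u' and x = x0 + x' contribute [u', x0], [y, x']
    and [u', x'], all of which lie in L_(i+2). *)
Lemma lcs_gen X Y i :
  (lcs 0 <= X + lcs 1)%VS -> (lcs i <= Y + lcs i.+1)%VS ->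
  (lcs i.+1 <= brv Y X + lcs i.+2)%VS.
Proof.
move=> /subvP sX /subvP sY; apply/brv_subP => u x uL _.
have /memv_addP[y yY [u' u'L uE]] := sY u uL.
have /memv_addP[x0 x0X [x' x'L ->]] := sX x (memvf x).
have yL : y \in lcs i.
  have -> : y = u - u' by rewrite uE addrK.
  by rewrite rpredB// (subvP (lcsS_sub i)).
rewrite linearDr uE linearDl -!addrA; apply: memv_add; first exact: mem_brv.
apply: rpredD; first exact: mem_brv u'L (memvf _).
by rewrite -uE; have := lcs_weight uL x'L; rewrite addn1.
Qed.

Lemma lcs_gen2 x y :
  (lcs 0 <= <[x]> + <[y]> + lcs 1)%VS -> (lcs 1 <= <[mu x y]> + lcs 2)%VS.
Proof.
move=> sL; apply: subv_trans (lcs_gen sL sL) _; rewrite subv_add addvSr andbT.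
apply: subv_trans _ (addvSl _ _).
apply: subv_trans (brv_addl _ _ _) _; rewrite subv_add.
apply/andP; split; apply: subv_trans (brv_addr _ _ _) _; rewrite subv_add.
  by rewrite brv_line_self sub0v brv_line.
by rewrite brv_line_self sub0v andbT (subv_trans (brv_anti_sub _ _))// brv_line.
Qed.

Lemma lcs_gen3 x y z :
  (lcs 0 <= <[x]> + <[y]> + <[z]> + lcs 1)%VS -> mu x y \in lcs 2 ->
  (lcs 1 <= <[mu x z]> + (<[mu y z]> + lcs 2))%VS.
Proof.
move=> sL xyL; apply: subv_trans (lcs_gen sL sL) _.
set W := (X in (_ <= X)%VS).
have line u v : mu u v \in W -> (brv <[u]> <[v]> <= W)%VS /\
    (brv <[v]> <[u]> <= W)%VS.
  move=> uvW; have sW : (brv <[u]> <[v]> <= W)%VS.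
    by apply: subv_trans (brv_line _ _) _; rewrite -memvE.
  by split=> //; apply: subv_trans (brv_anti_sub _ _) sW.
have LW : (lcs 2 <= W)%VS by rewrite /W addvA addvSr.
have [xyW yxW] := line x y (subvP LW _ xyL).
have [xzW zxW] := line x z (subvP (addvSl _ _) _ (memv_line _)).
have [yzW zyW] : (brv <[y]> <[z]> <= W)%VS /\ (brv <[z]> <[y]> <= W)%VS.
  apply: line; apply: (subvP (addvSr _ _)).
  exact: (subvP (addvSl _ _)) (memv_line _).
rewrite subv_add LW andbT.
have add3 U : (brv U <[x]> <= W -> brv U <[y]> <= W -> brv U <[z]> <= W ->
    brv U (<[x]> + <[y]> + <[z]>) <= W)%VS.
  move=> Ux Uy Uz; apply: subv_trans (brv_addr _ _ _) _; rewrite subv_add Uz.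
  by rewrite (subv_trans (brv_addr _ _ _))// subv_add Ux.
apply: subv_trans (brv_addl _ _ _) _; rewrite subv_add.
rewrite (subv_trans (brv_addl _ _ _)) ?subv_add;
  by rewrite !add3// brv_line_self sub0v.
Qed.

(** Modulo L_(i+1) both arguments are multiples of z, and [z, z] = 0. *)
Lemma lcs_cyclic_abelian i z :
  (lcs i <= <[z]> + lcs i.+1)%VS -> lcs (i + i.+1).+1 = 0%VS ->
  {in lcs i &, forall u v, mu u v = 0}.
Proof.
move=> sL L0 u v uL vL; have L i' j u' v' := @lcs_weight0 _ i' j u' v' L0.
have [k uk] := mem_add_line sL uL; have [l vl] := mem_add_line sL vL.
rewrite -(subrK (k *: z) u) linearDl (mu_anti (u - _)) (L i i.+1)// oppr0 add0r.
have zL : k *: z \in lcs i.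
  by rewrite -[_ *: _](subKr u) rpredB// (subvP (lcsS_sub _)).
rewrite -(subrK (l *: z) v) linearDr (L i i.+1)// add0r.
by rewrite linearZl_LR linearZr_LR altmap_alt !scaler0.
Qed.

(** * Dimensions of the graded pieces *)

(** Once two consecutive terms agree, the series is constant from there on; in
    a nilpotent algebra it therefore decreases strictly until it vanishes. *)
Lemma lcs_stationary i j : (lcs i <= lcs i.+1)%VS -> (lcs i <= lcs (i + j))%VS.
Proof.
move=> sL; elim: j => [|j IH]; first by rewrite addn0.
by rewrite addnS; apply: subv_trans sL _; apply: brvS.
Qed.

Lemma lcs_dimS i : (\dim (lcs i.+1) <= \dim (lcs i))%N.
Proof. exact/dimvS/lcsS_sub. Qed.

Lemma lcs_dim_lt i :
  nilpotent_alg mu -> \dim (lcs i) != 0%N ->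
  (\dim (lcs i.+1) < \dim (lcs i))%N.
Proof.
move=> [k Lk] Di; rewrite (ltn_leqif (dimv_leqif_sup (lcsS_sub i))).
apply: contra Di => /(lcs_stationary k) sL; rewrite dimv_eq0 -subv0 -Lk.
exact: subv_trans sL (lcs_sub (leq_addl _ _)).
Qed.

(** With a single generator x modulo L_1, the line spanned by [x, x] = 0 would
    generate L_1 modulo L_2, so that L_1 = L_2. *)
Lemma lcs1_codim :
  nilpotent_alg mu -> \dim (lcs 1) != 0%N ->
  (\dim (lcs 1) + 2 <= \dim (lcs 0))%N.
Proof.
move=> nmu /(lcs_dim_lt nmu); apply: contraLR; rewrite -ltnNge -leqNgt => D0.
have [|s [ss _]] := @subv_complement _ _ _ _ 1 (lcsS_sub 0); first by lia.
case: s ss => [|x []]// _; rewrite span_seq1 => sL; have := lcs_gen sL sL.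
by rewrite brv_line_self add0v => /dimvS.
Qed.

Lemma lcs_two_generators :
  (\dim (lcs 0) <= \dim (lcs 1) + 2)%N ->
  exists x y, (lcs 0 <= <[x]> + <[y]> + lcs 1)%VS.
Proof.
move=> D0; have [s [ss _]] := subv_complement (lcsS_sub 0) D0.
case: s ss => [|x [|y []]]// _; rewrite span_cons span_seq1 => sL.
by exists x, y.
Qed.

(** * Choice of generators *)

(** Some nonzero combination of x and y is sent into the hyperplane U of W by
    the bracket with w. Completing it to a basis of the same plane by a matrix
    of determinant one keeps the bracket of the two generators. *)
Lemma unimodular_choice U W x y w :
  (U <= W)%VS -> (\dim W <= (\dim U).+1)%N -> mu x w \in W -> mu y w \in W ->
  exists x' y', [/\ (<[x]> + <[y]> <= <[x']> + <[y']>)%VS,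
                    mu x' y' = mu x y & mu x' w \in U].
Proof.
move=> sUW dW xW yW; have [xU|xU] := boolP (mu x w \in U); first by exists x, y.
have [k yU] := mem_add_line (subv_add_line sUW dW xW xU) yW.
exists (y - k *: x), (- x); split.
- rewrite subv_add -!memvE; apply/andP; split.
    by rewrite -rpredN; apply: (subvP (addvSr _ _)); exact: memv_line.
  have {1}-> : y = (y - k *: x) + (- k) *: (- x).
    by rewrite scaleNr scalerN opprK subrK.
  by apply: memv_add; rewrite ?rpredZ// memv_line.
- rewrite linearNr linearBl linearZl_LR altmap_alt scaler0 subr0.
  by rewrite -mu_anti.
- by rewrite linearBl linearZl_LR.
Qed.

(** * The two computations with generators *)

(** Put z1 = [x1, x3], z2 = [x2, x3] and a = [x1, z2] in L_2. Since x1
    centralizes L_2 and [x1, x2] is in L_2, the Jacobi identity gives [x2, a]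
    = 0 and [z1, z2] = - [x3, a], while [x2, z1] agrees with a modulo the
    central term L_3; consequently [x2, [x3, z1]] = - 2 [z1, z2]. If a lies in
    L_3, then [x3, a] = 0. Otherwise a spans L_2 modulo L_3, so [x2, -]
    vanishes on L_2, which contains [x3, z1]. *)
Lemma three_generators_metabelian x1 x2 x3 :
  lcs 4 = 0%VS -> (\dim (lcs 2) <= (\dim (lcs 3)).+1)%N ->
  mu x1 x2 \in lcs 2 -> {in lcs 2, forall u, mu x1 u = 0} ->
  mu (mu x1 x3) (mu x2 x3) = 0.
Proof.
move=> L4 D2 x12 x1L.
have D i u : u \in lcs i -> forall x, mu x u \in lcs i.+1.
  by move=> uL x; rewrite mu_anti rpredN mem_brv ?memvf.
have muL1 x y : mu x y \in lcs 1 by rewrite mem_brv ?memvf.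
have comm0 u v : u \in lcs 1 -> v \in lcs 2 -> mu u v = 0.
  exact: lcs_weight0 L4 _.
have top0 x u : u \in lcs 3 -> mu x u = 0.
  exact: (@lcs_weight0 4 0 3 x u L4 isT (memvf x)).
have := muL1 x1 x3; have := muL1 x2 x3.
set z1 := mu x1 x3; set z2 := mu x2 x3; set a := mu x1 z2 => z2L z1L.
have aL : a \in lcs 2 by exact: D.
have x2a : mu x2 a = 0.
  have := mu_leibniz x1 x2 z2; rewrite (x1L _ (D _ _ z2L x2)).
  by rewrite (mu_anti (mu x1 x2)) comm0// oppr0 add0r.
have z12 : mu z1 z2 = - mu x3 a.
  have := mu_leibniz x1 x3 z2; rewrite (x1L _ (D _ _ z2L x3)) => /esym/eqP.
  by rewrite addr_eq0 => /eqP.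
have aE : mu x3 (mu x2 z1) = mu x3 a.
  have -> : mu x2 z1 = a - mu (mu x1 x2) x3.
    by rewrite /a /z2 mu_leibniz addrC addKr.
  by rewrite linearBr [X in _ - X]top0 ?subr0// mem_brv ?memvf.
have x23 : mu x2 (mu x3 z1) = - (mu z1 z2 + mu z1 z2).
  by rewrite mu_leibniz aE (mu_anti _ z1) -[mu x3 a]opprK -z12 opprD.
have [aL3|aL3] := boolP (a \in lcs 3); first by rewrite z12 top0 ?oppr0.
have [k] := mem_add_line (subv_add_line (lcsS_sub 2) D2 aL aL3) (D _ _ z1L x3).
move=> /(top0 x2); rewrite linearBr linearZr_LR x2a scaler0 subr0 x23 => /eqP.
by rewrite oppr_eq0 addr_eq0 => /eqP/eq_opp_eq0.
Qed.

(** Put e1 = [x, y], e3 = [x, e] and b = [y, e3] in L_4. Modulo the central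
    term L_5, [e1, e] is - b. Applying [mu y] and [mu x] to it, and using that
    L_2 is abelian, gives [y, b] = 0 and [e1, e3] = - [x, b]. Expanding [x, b]
    also gives [x, b] = [e1, e3] + [y, [x, e3]]. If b lies in L_5 then [x, b]
    = 0; otherwise b spans L_4 modulo L_5, so that [y, -] vanishes on L_4,
    which contains [x, e3]. *)
Lemma filiform_bracket0 x y e :
  lcs 6 = 0%VS -> (\dim (lcs 4) <= (\dim (lcs 5)).+1)%N ->
  {in lcs 2 &, forall u v, mu u v = 0} -> e \in lcs 2 -> mu y e \in lcs 4 ->
  mu (mu x y) (mu x e) = 0.
Proof.
move=> L6 D4 L2 eL yeL.
have D i u z : u \in lcs i -> mu z u \in lcs i.+1.
  by move=> uL; rewrite mu_anti rpredN mem_brv ?memvf.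
have top0 z u : u \in lcs 5 -> mu z u = 0.
  exact: (@lcs_weight0 6 0 5 z u L6 isT (memvf z)).
have e1L : mu x y \in lcs 1 by rewrite mem_brv ?memvf.
set e1 := mu x y in e1L *; set e3 := mu x e; set b := mu y e3.
have bL : b \in lcs 4 by rewrite !D.
have e12 : mu e1 e + b \in lcs 5 by rewrite /e1 /b /e3 -mu_leibniz D.
have mu_e12 z : mu z (mu e1 e) = - mu z b.
  by apply/eqP; rewrite -addr_eq0 -linearDr top0.
have yb : mu y b = 0.
  have := mu_leibniz y e1 e; rewrite (L2 _ _ (D _ _ _ e1L) eL) add0r mu_e12.
  rewrite (@lcs_weight0 6 1 4 e1 (mu y e))// => /eqP.
  by rewrite oppr_eq0 => /eqP.
have xb : mu e1 e3 = - mu x b.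
  by rewrite -mu_e12 mu_leibniz (L2 _ _ (D _ _ _ e1L) eL) add0r.
have [bL5|bL5] := boolP (b \in lcs 5); first by rewrite xb top0 ?oppr0.
have [k] := mem_add_line (subv_add_line (lcsS_sub 4) D4 bL bL5)
  (D _ _ x (D _ _ x eL)).
move=> /(top0 y); rewrite linearBr linearZr_LR yb scaler0 subr0 => ye3.
by apply: eq_opp_eq0; rewrite [LHS]xb mu_leibniz ye3 addr0.
Qed.

(** * The two families of extremal dimensions *)

Lemma four_step_metabelian :
  (\dim {:g} <= 7)%N -> lcs 4 = 0%VS -> {in lcs 1 &, forall u v, mu u v = 0}.
Proof.
move=> Dg L4; have nmu : nilpotent_alg mu by exists 4%N.
have [D3|D3] := eqVneq (\dim (lcs 3)) 0%N.
  have L3 : lcs 3 = 0%VS by apply/eqP; rewrite -dimv_eq0 D3.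
  by move=> u v; apply: lcs_weight0 L3 _.
have lt i := @lcs_dim_lt i nmu; have le := lcs_dimS.
have [D1|D1] := leqP (\dim (lcs 0)) (\dim (lcs 1) + 2).
  have [x [y /lcs_gen2 sL]] := lcs_two_generators D1.
  exact: lcs_cyclic_abelian sL L4.
have [D2|D2] := leqP (\dim (lcs 1)) (\dim (lcs 2) + 1).
  have [s [ss _]] := subv_complement (lcsS_sub 1) D2.
  case: s ss => [|z []]// _; rewrite span_seq1 => sL.
  exact: lcs_cyclic_abelian sL L4.
have dims : [/\ \dim (lcs 0) = 7, \dim (lcs 1) = 4, \dim (lcs 2) = 2
    & \dim (lcs 3) = 1]%N.
  move: (lt 2%N) (le 2%N) D3 D2 D1; rewrite -[\dim {:g}]/(\dim (lcs 0)) in Dg.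
  by move=> *; split; lia.
case: dims => E0 E1 E2 E3.
have [|s [ss _]] := @subv_complement _ _ _ _ 3 (lcsS_sub 0).
  by rewrite E0 E1.
case: s ss => [|x [|y [|z []]]]// _.
rewrite !span_cons span_nil addv0 addvA => sL.
(* Decomposability: if [x, y] is not in L_2, it spans with L_2 a hyperplane of
   L_1; after a change in the plane of x and y, [x', z] equals [x', k y']
   modulo L_2. *)
have [x1 [x2 [x3 [{}sL x12]]]] : exists x1 x2 x3,
    (lcs 0 <= <[x1]> + <[x2]> + <[x3]> + lcs 1)%VS /\ mu x1 x2 \in lcs 2.
  have [xyL|xyL] := boolP (mu x y \in lcs 2); first by exists x, y, z.
  have xyL1 : mu x y \in lcs 1 by rewrite mem_brv ?memvf.
  have sU : (<[mu x y]> + lcs 2 <= lcs 1)%VS.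
    by rewrite subv_add lcsS_sub -memvE xyL1.
  have [|||x' [y' [sL' xyE]]] := @unimodular_choice _ _ x y z sU.
  - have: (\dim (lcs 2) < \dim (<[mu x y]> + lcs 2))%N.
      rewrite (ltn_leqif (dimv_leqif_sup (addvSr _ _))).
      by rewrite subv_add subvv andbT -memvE.
    by rewrite E1 E2.
  - by rewrite mem_brv ?memvf.
  - by rewrite mem_brv ?memvf.
  rewrite -xyE => /(mem_add_line (subvv _))[k xzL].
  exists x', (z - k *: y'), y'; split; last by rewrite linearBr linearZr_LR.
  apply: subv_trans sL _; apply: addvS (subvv _); rewrite subv_add.
  rewrite (subv_trans sL') ?addvS ?addvSl//= -memvE.
  rewrite -[X in X \in _](subrK (k *: y') z).
  apply: memv_add; last by rewrite rpredZ// memv_line.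
  exact: (subvP (addvSr _ _)) (memv_line _).
have [|s [ss]] := @subv_complement _ _ _ _ 1 (lcsS_sub 2).
  by rewrite E2 E3.
case: s ss => [|w []]// _; rewrite span_seq1 -memvE => wL sw.
have xwL x' : mu x' w \in lcs 3 by rewrite mu_anti rpredN mem_brv ?memvf.
(* L_3 is a line, so a combination of x1 and x2 kills w. *)
have [|y1 [y2 [sy yE y1w]]] :=
  unimodular_choice (sub0v (lcs 3)) _ (xwL x1) (xwL x2).
  by rewrite E3 dimv0.
have y1L : {in lcs 2, forall u, mu y1 u = 0}.
  move=> u /(mem_add_line sw)[k uL].
  rewrite -(subrK (k *: w) u) linearDr linearZr_LR.
  move: y1w; rewrite memv0 => /eqP ->; rewrite scaler0 addr0.
  exact: (@lcs_weight0 4 0 3 y1 _ L4 isT (memvf y1) uL).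
have z12 : mu (mu y1 x3) (mu y2 x3) = 0.
  by apply: three_generators_metabelian; rewrite ?yE// E2 E3.
have sz : (lcs 1 <= <[mu y1 x3]> + (<[mu y2 x3]> + lcs 2))%VS.
  apply: lcs_gen3; rewrite ?yE//; apply: subv_trans sL _.
  exact: addvS (addvS sy (subvv _)) (subvv _).
have c0 u v : u \in lcs 1 -> v \in lcs 2 -> mu u v = 0.
  exact: lcs_weight0 L4 _.
have kill u : u \in lcs 1 -> mu u (mu y1 x3) = 0 -> mu u (mu y2 x3) = 0 ->
    {in lcs 1, forall v, mu u v = 0}.
  move=> uL u1 u2 v /(mem_add_line sz)[k /(mem_add_line (subvv _))[l vkl]].
  have := c0 u _ uL vkl; rewrite !linearBr !linearZr_LR u1 u2 !scaler0 !subr0.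
  by [].
have zL z' : mu z' x3 \in lcs 1 by rewrite mem_brv ?memvf.
have z21 : mu (mu y2 x3) (mu y1 x3) = 0 by rewrite mu_anti z12 oppr0.
move=> u v uL; apply: (kill u) => //.
  by rewrite mu_anti kill ?oppr0 ?altmap_alt.
by rewrite mu_anti kill ?oppr0 ?altmap_alt.
Qed.

Lemma brv_lcs13_dim7 :
  \dim {:g} = 7%N -> nilpotent_alg mu -> brv (lcs 1) (lcs 3) = 0%VS.
Proof.
move=> Dg nmu; apply/eqP; rewrite -subv0.
have D u z i : u \in lcs i -> mu z u \in lcs i.+1.
  by move=> uL; rewrite mu_anti rpredN mem_brv ?memvf.
have lt i := @lcs_dim_lt i nmu.
have [D5|D5] := eqVneq (\dim (lcs 5)) 0%N.
  have L5 : lcs 5 = 0%VS by apply/eqP; rewrite -dimv_eq0 D5.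
  by apply/brv_subP => u v uL vL; rewrite (lcs_weight0 L5 _ uL vL)// mem0v.
have pos i : (i <= 5)%N -> \dim (lcs i) != 0%N.
  by move=> /lcs_sub/dimvS; lia.
have dims : [/\ \dim (lcs 1) = 5, \dim (lcs 2) = 4, \dim (lcs 3) = 3,
    \dim (lcs 4) = 2 & \dim (lcs 5) = 1]%N /\ \dim (lcs 6) = 0%N.
  have := lcs1_codim nmu (pos 1%N isT); rewrite -[\dim (lcs 0)]/(\dim {:g}) Dg.
  move: (lt 1%N (pos 1%N isT)) (lt 2%N (pos 2%N isT)) (lt 3%N (pos 3%N isT)).
  move: (lt 4%N (pos 4%N isT)) (lt 5%N (pos 5%N isT)) D5.
  by move=> *; do !split; lia.
have [[E1 E2 E3 E4 E5] E6] := dims.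
have L6 : lcs 6 = 0%VS by apply/eqP; rewrite -dimv_eq0 E6.
have [|x [y sxy]] := lcs_two_generators; first by rewrite E1 [\dim _]Dg.
have [|s [ss]] := @subv_complement _ _ _ _ 1 (lcsS_sub 2).
  by rewrite E2 E3.
case: s ss => [|e []]// _; rewrite span_seq1 -memvE => eL se.
have L22 : {in lcs 2 &, forall u v, mu u v = 0}.
  exact: lcs_cyclic_abelian se L6.
have [|y' [x' [sL xyE y'e]]] :=
  unimodular_choice (lcsS_sub 3) _ (D _ x _ eL) (D _ y _ eL).
  by rewrite E3 E4.
have {sxy} sL0 : (lcs 0 <= <[x']> + <[y']> + lcs 1)%VS.
  by rewrite (addvC <[x']>%VS) (subv_trans sxy)// addvS.
have L1 := lcs_gen2 sL0.
have L3 : (lcs 3 <= <[mu x' e]> + lcs 4)%VS.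
  apply: subv_trans (lcs_gen sL0 se) _; rewrite subv_add addvSr andbT.
  apply: subv_trans (brv_addr _ _ _) _; rewrite subv_add.
  have line z : (brv <[e]> <[z]> <= <[mu z e]>)%VS.
    exact: subv_trans (brv_anti_sub _ _) (brv_line _ _).
  apply/andP; split; apply: subv_trans (line _) _; first exact: addvSl.
  by rewrite -memvE (subvP (addvSr _ _)).
have core : mu (mu x' y') (mu x' e) = 0.
  by apply: filiform_bracket0; rewrite ?E4 ?E5.
apply/brv_subP => u v uL vL; rewrite memv0.
have [k uk] := mem_add_line L1 uL; have [l vl] := mem_add_line L3 vL.
have xyL : mu x' y' \in lcs 1 by rewrite mem_brv ?memvf.
rewrite -(subrK (k *: mu x' y') u) linearDl (lcs_weight0 L6 _ uk vL)// add0r.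
rewrite -(subrK (l *: mu x' e) v) linearDr linearZl_LR.
rewrite (lcs_weight0 L6 _ xyL vl)// scaler0 add0r.
by rewrite linearZl_LR linearZr_LR core !scaler0.
Qed.

(** * Iterated brackets *)

Lemma Nmap_lcs k (x : 'I_k.+1 -> g) : Nmap mu x \in lcs k.
Proof.
elim: k x => [|k IH] x; first exact: memvf.
by apply: mem_brv; [apply: IH | apply: memvf].
Qed.

(** Induction on k: the last argument y of the bracket is moved to the other
    side, by replacing X with its preimage under the bracket with y. *)
Lemma lcs_subNmap k X :
  (forall x : 'I_k.+1 -> g, Nmap mu x \in X) -> (lcs k <= X)%VS.
Proof.
elim: k X => [|k IH] X NX.
  by apply/subvP => v _; exact: (NX (fun=> v)).
apply/brv_subP => u y uL _.
suff /subvP/(_ u uL) : (lcs k <= linfun (applyr mu y) @^-1: X)%VS.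
  by rewrite -memv_preim lfunE.
apply: IH => x; rewrite -memv_preim lfunE /=.
pose x' (i : 'I_k.+2) := if unlift ord_max i is Some j then x j else y.
have := NX x'; rewrite /= {2}/x' unlift_none.
congr (mu (Nmap mu _) y \in X); apply/funext => i; rewrite /x'.
have -> : widen_ord (leqnSn k.+1) i = lift ord_max i.
  by apply: val_inj; exact: (esym (lift_max i)).
by rewrite liftK.
Qed.

Lemma lcs_Nmap0 k :
  (forall x : 'I_k.+1 -> g, Nmap mu x = 0) -> lcs k = 0%VS.
Proof.
by move=> N0; apply/eqP; rewrite -subv0 lcs_subNmap// => x; rewrite N0 mem0v.
Qed.

End LowerCentralSeries.

Theorem mainTheorem3 (R : realType) :
  [/\ forall (n : nat) (g : vectType R),
        [\/ n = 5%N, n = 6%N | n = 7%N] -> \dim {:g} = n ->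
        nil_variety g 4 `<=` snil_variety g 3,
      forall g : vectType R,
        \dim {:g} = 7%N -> nil_variety g 6 `<=` snil_variety g 5
    & forall (g : vectType R) (mu : altmap g),
        \dim {:g} = 7%N -> jacobi mu -> nilpotent_alg mu ->
        brv mu (lcs mu 1) (lcs mu 3) = 0%VS].
Proof.
split.
- move=> n g n567 Dg mu [Jmu /lcs_Nmap0 L4]; split=> // x.
  apply: (four_step_metabelian Jmu _ L4); first by rewrite Dg; case: n567 => ->.
    by rewrite mem_brv ?memvf.
  exact: Nmap_lcs.
- move=> g Dg mu [Jmu /lcs_Nmap0 L6]; split=> // x.
  apply/eqP; rewrite -memv0 -(brv_lcs13_dim7 Jmu Dg); last by exists 6%N.
  by apply: mem_brv; [rewrite mem_brv ?memvf | apply: Nmap_lcs].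
- by move=> g mu Dg Jmu; exact: brv_lcs13_dim7.
Qed.
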